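(* Let $V>0$ and $\epsilon\ge0$ be fixed, let $x_{max}\ge\max[a_{max},\epsilon]$, and let $(s(t),a(t),\gamma(t))_{t\ge0}$ be an arbitrary sample path with $0\le s(t)\le s_{max}$, $0\le a(t)\le a_{max}$, $0\le\gamma(t)\le\gamma_{max}$ for all $t$. Suppose $Q(0)=Z(0)=0$ and that for all $t\in\{0,1,2,\ldots\}$ $$x(t)=\begin{cases}0&\text{if }Q(t)+Z(t)\le V\gamma(t),\\ x_{max}&\text{otherwise,}\end{cases}$$ $$Q(t+1)=\max[Q(t)-s(t)-x(t),0]+a(t),$$ $$Z(t+1)=\max[Z(t)-s(t)-x(t)+\epsilon1_{\{Q(t)>0\}},0].$$ Then $Q(t)\le Q_{max}=V\gamma_{max}+a_{max}$ for all $t$, and every request is fulfilled with delay at most $D_{max}=\lceil(2V\gamma_{max}+a_{max}+\epsilon)/\epsilon\rceil$ slots (for $\epsilon=0$ one reads $D_{max}=\infty$, so that no delay assertion is made). Further, for all positive integers $T$ and $R$, $$\frac{1}{RT}\sum_{\tau=0}^{RT-1}\gamma(\tau)x(\tau)\le\frac1R\sum_{r=0}^{R-1}c_r^*+\frac{BT}{V},$$ where $$B=\frac{(s_{max}+x_{max})^2+a_{max}^2}{2}+\frac{\max[\epsilon^2,(s_{max}+x_{max})^2]}{2}$$ and, for each $r\in\{0,1,\ldots,R-1\}$, $c_r^*$ is the optimal value of the $T$-slot lookahead problem: minimize $$\frac1T\sum_{\tau=rT}^{(r+1)T-1}\gamma(\tau)x^*(\tau)$$ over $x^*(\tau)$,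 $\tau\in\{rT,\ldots,(r+1)T-1\}$, subject to $$\sum_{\tau=rT}^{(r+1)T-1}[s(\tau)+x^*(\tau)-a(\tau)]\ge0,\qquad \sum_{\tau=rT}^{(r+1)T-1}[s(\tau)+x^*(\tau)-\epsilon]\ge0,$$ $$0\le x^*(\tau)\le x_{max}\ \text{ for all }\tau\in\{rT,\ldots,(r+1)T-1\}.$$
   Context: Here $s(t)$ is renewable supply, $a(t)$ energy requests arriving on slot $t$, $\gamma(t)$ the per-unit price of outside energy, $x(t)$ the outside energy used, $Q(t)$ the queue of unserved requests and $Z(t)$ a virtual queue; $s_{max},a_{max},\gamma_{max},x_{max}$ are finite constants. $1_{\{Q(t)>0\}}$ is $1$ if $Q(t)>0$ and $0$ otherwise. No probabilistic assumption is made: the processes may follow any probability model with arbitrary time correlations, and the result holds for every sample path within the bounds. Delay: service is First-In-First-Out. Requests $a(t)$ are first available for service on slot $t+1$ and are part of $Q(t+1)$. On slot $\tau$ the amount served is $\min[Q(\tau),s(\tau)+x(\tau)]$. The requests $a(t)$ are fulfilled with delay at most $D$ slots if they are served on or before slot $t+D$, i.e. $\sum_{\tau=t+1}^{t+D}\min[Q(\tau),s(\tau)+x(\tau)]\ge Q(t+1)$. *)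

(* Defs.v *)
From mathcomp Require Import all_boot all_order all_algebra.
From mathcomp Require Import boolp classical_sets reals.
Set Implicit Arguments.
Unset Strict Implicit.
Unset Printing Implicit Defensive.
Import Order.TTheory GRing.Theory Num.Theory.
Local Open Scope classical_set_scope.
Local Open Scope ring_scope.

(* The requests a t join the FIFO queue at slot t+1, so they are all served by
   slot t+D iff the amounts min(Q, s + x) served on slots t+1, ..., t+D add up
   to at least the whole backlog Q(t+1). *)
Definition fulfilled_within (R : realType) (s x Q : nat -> R) (t D : nat) : Prop :=
  Q t.+1 <= \sum_(t.+1 <= tau < t.+1 + D) Num.min (Q tau) (s tau + x tau).

Definition Qmax (R : realType) (V gmax amax : R) : R := V * gmax + amax.

(* Meaningful for 0 < eps and nonnegative V, gmax, amax: the quotient is then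
   at least 1, so the absolute value only casts its ceiling from int to nat. *)
Definition Dmax (R : realType) (V gmax amax eps : R) : nat :=
  `|Num.ceil ((2 * V * gmax + amax + eps) / eps)|%N.

Definition Bconst (R : realType) (smax amax xmax eps : R) : R :=
  ((smax + xmax) ^+ 2 + amax ^+ 2) / 2
  + Num.max (eps ^+ 2) ((smax + xmax) ^+ 2) / 2.

(* The values of y outside the r-th frame {rT, ..., (r+1)T-1} are irrelevant. *)
Definition lookahead_feasible (R : realType) (s a : nat -> R) (eps xmax : R)
    (T r : nat) (y : nat -> R) : Prop :=
  [/\ 0 <= \sum_(r * T <= tau < r.+1 * T) (s tau + y tau - a tau),
      0 <= \sum_(r * T <= tau < r.+1 * T) (s tau + y tau - eps)
    & forall tau : nat, (r * T <= tau < r.+1 * T)%N -> 0 <= y tau <= xmax].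

Definition lookahead_cost (R : realType) (g : nat -> R) (T r : nat)
    (y : nat -> R) : R :=
  T%:R^-1 * \sum_(r * T <= tau < r.+1 * T) g tau * y tau.

(* The optimal value c_r^*. If 0 <= s, 0 <= g, a <= amax and
   xmax >= max(amax, eps, 0), the constant xmax is feasible and costs are
   nonnegative, so inf is not taken of an empty or unbounded set. *)
Definition lookahead_opt (R : realType) (s a g : nat -> R) (eps xmax : R)
    (T r : nat) : R :=
  inf [set lookahead_cost g T r y | y in lookahead_feasible s a eps xmax T r].

(* Main.v *)
Require Import Defs.
From mathcomp Require Import all_boot all_order all_algebra.
From mathcomp Require Import boolp classical_sets reals.
From mathcomp Require Import lra ring.
Set Implicit Arguments.
Unset Strict Implicit.
Unset Printing Implicit Defensive.
Import Order.TTheory GRing.Theory Num.Theory.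
Local Open Scope ring_scope.

(** The decision rule is greedy: x(t) minimizes (V g(t) - Q(t) - Z(t)) y over
    all y in [0, xmax].

    Queue bounds. Once a queue exceeds V gmax the rule spends xmax, which
    dominates the inflow of either queue, so the queue cannot grow any more;
    it therefore overshoots V gmax by at most one slot of inflow
    ([threshold_bound]). This gives Q <= V gmax + amax and Z <= V gmax + eps.

    Delay. If the backlog Q(t+1) is not cleared within D slots, then Q exceeds
    s + x throughout these slots ([backlog_busy]). Hence everything offered is
    served, less than Q(t+1) in total, while the virtual queue receives eps on
    each slot. So Z gains more than D eps - Q(t+1), and for D = Dmax this
    contradicts the bound on Z.

    Cost. Let L = (Q^2 + Z^2) / 2. Expanding the squares and using greediness
    ([slot_drift]), each slot satisfies, for every alternative y in [0, xmax],
      Delta L + V g x <= B + V g y + Q (a - s - y) + Z (eps - s - y).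
    Over a frame of T slots with y feasible for the lookahead problem, replace
    Q and Z by their values at the start of the frame: the linear terms then
    have nonpositive sums, and since the queues move by a bounded amount per
    slot the replacement costs at most 2 B (0 + 1 + ... + (T-1))
    ([frame_inner_product]). The frame total is at most
    T B + T (T-1) B = T^2 B, uniformly in y, so y may be replaced by the infimum
    ([frame_cost]). Summing over frames telescopes L, which starts at 0 and
    stays nonnegative. *)

(** * Queue bounds and delay *)

(** Crossing M takes one step of size at most c, and above M there is no growth
    beyond the larger of the present value and M + c. *)
Lemma threshold_bound (R : realType) (u : nat -> R) (M c : R) :
  u 0%N <= M + c ->
  (forall t, u t <= M -> u t.+1 <= M + c) ->
  (forall t, M < u t -> u t.+1 <= Num.max (u t) (M + c)) ->
  forall t, u t <= M + c.
Proof.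
move=> u0 below above; elim=> [//|t IH].
have [/below//|/above h] := leP (u t) M.
by apply: le_trans h _; rewrite ge_max IH lexx.
Qed.

(** The work served plus the work still present never falls below the initial
    backlog, since a slot removes min(q, b) and arrivals only add. *)
Lemma backlog_le_served (R : realType) (q a b : nat -> R) :
  (forall t, 0 <= a t) ->
  (forall t, q t.+1 = Num.max (q t - b t) 0 + a t) ->
  forall t0 n,
    q t0 <= q (t0 + n)%N + \sum_(t0 <= t < t0 + n) Num.min (q t) (b t).
Proof.
move=> a_ge0 qE t0; elim=> [|n IH].
  by rewrite addn0 big_geq // addr0.
rewrite addnS big_nat_recr ?leq_addr //= qE.
apply: le_trans IH _; have := a_ge0 (t0 + n)%N.
by case: (leP (q (t0 + n)%N) (b (t0 + n)%N)) => h;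
  case: (leP (q (t0 + n)%N - b (t0 + n)%N) 0) => k; lra.
Qed.

(** A slot with q <= b empties the queue, at which point all of the initial
    backlog has been served. *)
Lemma backlog_busy (R : realType) (q a b : nat -> R) :
  (forall t, 0 <= a t) -> (forall t, 0 <= b t) -> (forall t, 0 <= q t) ->
  (forall t, q t.+1 = Num.max (q t - b t) 0 + a t) ->
  forall t0 n,
    \sum_(t0 <= t < t0 + n) Num.min (q t) (b t) < q t0 ->
  forall t, (t0 <= t < t0 + n)%N -> b t < q t.
Proof.
move=> a_ge0 b_ge0 q_ge0 qE t0 n unserved t /andP[t0t tn].
rewrite ltNge; apply/negP => qb; move: unserved; apply/negP; rewrite -leNgt.
rewrite (@big_cat_nat _ _ _ t.+1) ?(leq_trans t0t) //= big_nat_recr //=.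
have := backlog_le_served a_ge0 qE t0 (t - t0); rewrite subnKC // => h.
have rest : 0 <= \sum_(t.+1 <= i < t0 + n) Num.min (q i) (b i).
  by apply: sumr_ge0 => i _; rewrite le_min q_ge0 b_ge0.
by rewrite (min_idPl qb); lra.
Qed.

(** * Drift over one slot *)

(** Squaring is monotone although q - b may be negative, because max(q - b, 0)
    has at most the absolute value of q - b; in the cross term it is at most q. *)
Lemma sqr_queue_step (R : realType) (q a b : R) :
  0 <= q -> 0 <= a -> 0 <= b ->
  (Num.max (q - b) 0 + a) ^+ 2 <= q ^+ 2 + (b ^+ 2 + a ^+ 2) + 2 * q * (a - b).
Proof.
move=> q0 a0 b0; have ab := mulr_ge0 a0 b0; have aq := mulr_ge0 a0 q0.
by have := sqr_ge0 (q - b); case: (leP (q - b) 0) => h; nra.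
Qed.

Lemma sqr_le_max (R : realType) (p q w : R) :
  - p <= w <= q -> w ^+ 2 <= Num.max (p ^+ 2) (q ^+ 2).
Proof.
move=> /andP[h1 h2]; rewrite le_max; apply/orP.
by case: (leP 0 w) => w0; [right|left]; nra.
Qed.

Lemma greedy_le (R : realType) (w c m y : R) :
  0 <= y <= m ->
  (c - w) * (if w <= c then 0 else m) <= (c - w) * y.
Proof. by move=> /andP[y0 ym]; case: (leP w c) => h; nra. Qed.

(** The quadratic terms of the two queue updates are absorbed by the constant;
    the linear ones recombine with V g x into (V g - (q + z)) x, which the greedy
    choice makes no larger than with y. *)
Lemma slot_drift (R : realType)
    (V eps smax amax xmax s a g q z x y q' z' : R) :
  0 <= eps -> 0 <= q -> 0 <= z ->
  0 <= s <= smax -> 0 <= a <= amax -> 0 <= x <= xmax ->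
  (V * g - (q + z)) * x <= (V * g - (q + z)) * y ->
  q' = Num.max (q - s - x) 0 + a ->
  z' = Num.max (z - s - x + eps * (if 0 < q then 1 else 0)) 0 ->
  (q' ^+ 2 + z' ^+ 2) / 2 - (q ^+ 2 + z ^+ 2) / 2 + V * (g * x)
  <= Bconst smax amax xmax eps + V * (g * y)
     + (q * (a - s - y) + z * (eps - s - y)).
Proof.
move=> e0 q0 z0 /andP[s0 s1] /andP[a0 a1] /andP[x0 x1] greedy -> ->.
rewrite /Bconst.
set e := eps * _.
have [ee0 ee1] : 0 <= e /\ e <= eps.
  by rewrite /e; case: ifP => _; rewrite ?mulr1 ?mulr0; split.
have Q2 : (Num.max (q - s - x) 0 + a) ^+ 2 <=
          q ^+ 2 + ((smax + xmax) ^+ 2 + amax ^+ 2) + 2 * q * (a - (s + x)).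
  have b0 : 0 <= s + x by lra.
  have := sqr_queue_step q0 a0 b0; rewrite opprD addrA => h.
  apply: le_trans h _; rewrite lerD2r lerD2l lerD //.
    by apply: lerXn2r; rewrite ?nnegrE; lra.
  by apply: lerXn2r; rewrite ?nnegrE; lra.
have Z2 : (Num.max (z - s - x + e) 0) ^+ 2 <=
          z ^+ 2 + Num.max (eps ^+ 2) ((smax + xmax) ^+ 2)
          + 2 * z * (eps - (s + x)).
  have w2 : (e - (s + x)) ^+ 2 <= Num.max (eps ^+ 2) ((smax + xmax) ^+ 2).
    by rewrite maxC; apply: sqr_le_max; apply/andP; split; lra.
  (* On a slot with an empty queue e = 0, and replacing it by eps in the linear
     term only weakens the bound, as z >= 0. *)
  have ze : z * e <= z * eps by rewrite ler_wpM2l.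
  have zw : (z - s - x + e) ^+ 2 <=
     z ^+ 2 + Num.max (eps ^+ 2) ((smax + xmax) ^+ 2) + 2 * z * (eps - (s + x)).
    move: w2; set m := Num.max _ _ => w2.
    by rewrite (_ : z - s - x + e = z + (e - (s + x))); [nra|ring].
  apply: le_trans zw; case: (leP (z - s - x + e) 0) => // _.
  by rewrite expr0n sqr_ge0.
move: Q2 Z2 greedy; set m := Num.max (eps ^+ 2) _; set S := (smax + xmax) ^+ 2.
set A := Num.max _ _; set Z' := Num.max _ _.
move: (A + a) => Q' Q2 Z2 greedy; nra.
Qed.

(** * Comparison over a frame *)

Lemma drift_bound (R : realType) (u : nat -> R) (p q : R) :
  (forall t, - p <= u t.+1 - u t <= q) ->
  forall m k, - (k%:R * p) <= u (m + k)%N - u m <= k%:R * q.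
Proof.
move=> step m; elim=> [|k IH]; first by rewrite addn0; lra.
move: IH (step (m + k)%N); rewrite addnS -natr1 => /andP[h1 h2] /andP[h3 h4].
by apply/andP; split; lra.
Qed.

Lemma mul_le_max_sqr (R : realType) (p q k d w : R) :
  0 <= p -> 0 <= q -> 0 <= k ->
  - (k * p) <= d <= k * q -> - p <= w <= q ->
  d * w <= k * Num.max (p ^+ 2) (q ^+ 2).
Proof.
move=> p0 q0 k0 dk wpq.
have [m [m0 pm qm ->]] : exists m, [/\ 0 <= m, p <= m, q <= m
    & Num.max (p ^+ 2) (q ^+ 2) = m ^+ 2].
  have [pq|/ltW qp] := leP p q.
    exists q; split=> //; apply/max_idPr; exact: lerXn2r.
  exists p; split=> //; apply/max_idPl; exact: lerXn2r.
have nd : `|d| <= k * m.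
  move: dk; rewrite ler_norml => /andP[h1 h2]; apply/andP; split; nra.
have nw : `|w| <= m.
  by move: wpq; rewrite ler_norml => /andP[h1 h2]; apply/andP; split; lra.
apply: le_trans (ler_norm _) _; rewrite normrM expr2 mulrA.
exact: ler_pM.
Qed.

(** Freezing u at its value at the start of the frame makes the sum nonpositive
    by hypothesis. On the k-th slot of the frame u has drifted by at most k steps,
    and since w obeys the same bounds as one step of u, the error is at most
    k max(p^2, q^2); the factor T(T-1)/2 is 0 + 1 + ... + (T-1). *)
Lemma frame_inner_product (R : realType) (u w : nat -> R) (p q : R) (m T : nat) :
  0 <= p -> 0 <= q ->
  (forall t, - p <= u t.+1 - u t <= q) ->
  (forall t, (m <= t < m + T)%N -> - p <= w t <= q) ->
  0 <= u m -> \sum_(m <= t < m + T) w t <= 0 ->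
  \sum_(m <= t < m + T) u t * w t
  <= T%:R * (T%:R - 1) / 2 * Num.max (p ^+ 2) (q ^+ 2).
Proof.
move=> p0 q0 step wB um sw; set M := Num.max _ _.
suff h : forall n, (n <= T)%N ->
    \sum_(m <= t < m + n) u t * w t <=
    u m * (\sum_(m <= t < m + n) w t) + n%:R * (n%:R - 1) / 2 * M.
  apply: le_trans (h T (leqnn T)) _.
  by rewrite gerDr; apply: mulr_ge0_le0.
elim=> [_|n IH nT]; first by rewrite addn0 !big_geq //; lra.
rewrite addnS !big_nat_recr ?leq_addr //=.
have wn : - p <= w (m + n)%N <= q.
  by apply: wB; rewrite leq_addr ltn_add2l.
have := mul_le_max_sqr p0 q0 (ler0n R n) (drift_bound step m n) wn.
have := IH (ltnW nT); rewrite -(natr1 n) -/M.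
set s1 := \sum_(_ <= _ < _) _; set s2 := \sum_(_ <= _ < _) _; lra.
Qed.

(** * The controlled queues *)

Section Controller.
Variables (R : realType) (V eps smax amax gmax xmax : R).
Variables s a g x Q Z : nat -> R.
Hypothesis V_gt0 : 0 < V.
Hypothesis eps_ge0 : 0 <= eps.
Hypothesis xmax_ge : Num.max amax eps <= xmax.
Hypothesis s_bnd : forall t, 0 <= s t <= smax.
Hypothesis a_bnd : forall t, 0 <= a t <= amax.
Hypothesis g_bnd : forall t, 0 <= g t <= gmax.
Hypotheses (Q0 : Q 0%N = 0) (Z0 : Z 0%N = 0).
Hypothesis xE : forall t, x t = if Q t + Z t <= V * g t then 0 else xmax.
Hypothesis QE : forall t, Q t.+1 = Num.max (Q t - s t - x t) 0 + a t.
Hypothesis ZE : forall t,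
  Z t.+1 = Num.max (Z t - s t - x t + eps * (if 0 < Q t then 1 else 0)) 0.

Let amax_le : amax <= xmax.
Proof. by move: xmax_ge; rewrite ge_max => /andP[]. Qed.

Let eps_le : eps <= xmax.
Proof. by move: xmax_ge; rewrite ge_max => /andP[]. Qed.

Let amax_ge0 : 0 <= amax.
Proof. by have /andP[] := a_bnd 0; exact: le_trans. Qed.

Let smax_ge0 : 0 <= smax.
Proof. by have /andP[] := s_bnd 0; exact: le_trans. Qed.

Let xmax_ge0 : 0 <= xmax.
Proof. exact: le_trans eps_le. Qed.

Lemma x_bnd t : 0 <= x t <= xmax.
Proof. by rewrite xE; case: ifP => _; rewrite xmax_ge0 lexx. Qed.

Lemma Q_ge0 t : 0 <= Q t.
Proof.
case: t => [|t]; first by rewrite Q0.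
by rewrite QE addr_ge0 ?le_max ?lexx ?orbT //; have /andP[] := a_bnd t.
Qed.

Lemma Z_ge0 t : 0 <= Z t.
Proof. by case: t => [|t]; rewrite ?Z0 // ZE le_max lexx orbT. Qed.

Lemma price_le t : V * g t <= V * gmax.
Proof. by rewrite ler_pM2l //; have /andP[] := g_bnd t. Qed.

Lemma x_above t : V * gmax < Q t + Z t -> x t = xmax.
Proof. by move=> h; rewrite xE leNgt (le_lt_trans (price_le t) h). Qed.

Lemma inflow_Z_bnd t : 0 <= eps * (if 0 < Q t then 1 else 0) <= eps.
Proof. by case: ifP => _; rewrite ?mulr1 ?mulr0 lexx ?eps_ge0. Qed.

Let Vgmax_ge0 : 0 <= V * gmax.
Proof.
have /andP[g0 g1] := g_bnd 0%N; apply: mulr_ge0; first exact: ltW.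
exact: le_trans g1.
Qed.

Lemma Q_le t : Q t <= V * gmax + amax.
Proof.
apply: (@threshold_bound _ Q); first by rewrite Q0 addr_ge0.
- move=> {}t h; rewrite QE.
  have /andP[_ a1] := a_bnd t; have /andP[s0 _] := s_bnd t.
  have /andP[x0 _] := x_bnd t.
  by have := Vgmax_ge0; case: (leP (Q t - s t - x t) 0) => k; lra.
- move=> {}t h; have xt : x t = xmax.
    by apply: x_above; have := Z_ge0 t; lra.
  rewrite QE xt le_max; apply/orP.
  have /andP[_ a1] := a_bnd t; have /andP[s0 _] := s_bnd t.
  have := Vgmax_ge0; have := amax_le.
by case: (leP (Q t - s t - xmax) 0) => k; [right|left]; lra.
Qed.

Lemma Z_le t : Z t <= V * gmax + eps.
Proof.
apply: (@threshold_bound _ Z); first by rewrite Z0 addr_ge0.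
- move=> {}t h; rewrite ZE.
  have /andP[_ e1] := inflow_Z_bnd t; have /andP[s0 _] := s_bnd t.
  have /andP[x0 _] := x_bnd t.
  by have := Vgmax_ge0; have := eps_ge0; rewrite ge_max => *; apply/andP; split; lra.
- move=> {}t h; have xt : x t = xmax.
    by apply: x_above; have := Q_ge0 t; lra.
  rewrite ZE xt le_max; apply/orP; left.
  have /andP[_ e1] := inflow_Z_bnd t; have /andP[s0 _] := s_bnd t.
  by have := eps_le; rewrite ge_max Z_ge0 andbT; lra.
Qed.

(** While Q stays positive the virtual queue collects eps per slot and loses at
    most the service offered. *)
Lemma Z_growth t0 n :
  (forall t, (t0 <= t < t0 + n)%N -> 0 < Q t) ->
  n%:R * eps - \sum_(t0 <= t < t0 + n) (s t + x t) <= Z (t0 + n)%N.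
Proof.
elim: n => [|n IH] busy; first by rewrite addn0 big_geq // mul0r subr0 Z_ge0.
rewrite addnS big_nat_recr ?leq_addr //= ZE busy; last first.
  by rewrite leq_addr addnS /=.
rewrite le_max -natr1; apply/orP; left.
have {IH}: n%:R * eps - \sum_(t0 <= t < t0 + n) (s t + x t) <= Z (t0 + n)%N.
  apply: IH => t /andP[h1 h2]; apply: busy.
  by rewrite h1 addnS ltnS ltnW.
by set b := \sum_(_ <= _ < _) _; lra.
Qed.

(** Throughout a busy period the offered service is the work served, so a backlog
    that outlives Dmax slots would push Z above its bound. *)
Lemma delay_bound : 0 < eps ->
  forall t, fulfilled_within s x Q t (Dmax V gmax amax eps).
Proof.
move=> eps_gt0 t; rewrite /fulfilled_within leNgt; apply/negP.
set D := Dmax _ _ _ _ => unserved.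
have b_ge0 t' : 0 <= s t' + x t'.
  by have /andP[s0 _] := s_bnd t'; have /andP[x0 _] := x_bnd t'; rewrite addr_ge0.
have a_ge0 t' : 0 <= a t' by have /andP[] := a_bnd t'.
have QE' t' : Q t'.+1 = Num.max (Q t' - (s t' + x t')) 0 + a t'.
  by rewrite QE opprD addrA.
have busy := backlog_busy a_ge0 b_ge0 Q_ge0 QE' unserved.
have := Z_growth (fun t' h => le_lt_trans (b_ge0 t') (busy t' h)).
have -> : \sum_(t.+1 <= t' < t.+1 + D) (s t' + x t') =
          \sum_(t.+1 <= t' < t.+1 + D) Num.min (Q t') (s t' + x t').
  by apply: eq_big_nat => t' /busy/ltW/min_idPr ->.
have D_ge : 2 * V * gmax + amax + eps <= D%:R * eps.
  rewrite -ler_pdivrMr //; apply: le_trans (ceil_ge _) _.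
  by rewrite /D /Dmax natr_absz ler_int ler_norm.
have := Q_le t.+1; have := Z_le (t.+1 + D).
move: unserved; set c := \sum_(_ <= _ < _) _.
by lra.
Qed.

Lemma Q_step t : - (smax + xmax) <= Q t.+1 - Q t <= amax.
Proof.
rewrite QE; have /andP[s0 s1] := s_bnd t; have /andP[x0 x1] := x_bnd t.
have /andP[a0 a1] := a_bnd t; have q0 := Q_ge0 t.
have [amax0 smax0 xmax0] := And3 amax_ge0 smax_ge0 xmax_ge0.
by case: (leP (Q t - s t - x t) 0) => h; apply/andP; split; lra.
Qed.

Lemma Z_step t : - (smax + xmax) <= Z t.+1 - Z t <= eps.
Proof.
rewrite ZE; have /andP[s0 s1] := s_bnd t; have /andP[x0 x1] := x_bnd t.
have /andP[e0 e1] := inflow_Z_bnd t; have z0 := Z_ge0 t.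
have [eps0 smax0 xmax0] := And3 eps_ge0 smax_ge0 xmax_ge0.
move: e0 e1; set e := eps * _ => e0 e1.
by case: (leP (Z t - s t - x t + e) 0) => h; apply/andP; split; lra.
Qed.

Let L t := (Q t ^+ 2 + Z t ^+ 2) / 2.

Let B := Bconst smax amax xmax eps.

Lemma frame_drift T r y : lookahead_feasible s a eps xmax T r y ->
  L (r.+1 * T)%N - L (r * T)%N
    + V * (\sum_(r * T <= t < r.+1 * T) g t * x t)
  <= T%:R ^+ 2 * B + V * (\sum_(r * T <= t < r.+1 * T) g t * y t).
Proof.
case; rewrite mulSnr; set m := (r * T)%N => feasQ feasZ y_bnd.
have S_ge0 : 0 <= smax + xmax by rewrite addr_ge0.
have frameQ : \sum_(m <= t < m + T) Q t * (a t - s t - y t) <=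
    T%:R * (T%:R - 1) / 2 * Num.max ((smax + xmax) ^+ 2) (amax ^+ 2).
  apply: frame_inner_product Q_step _ (Q_ge0 m) _ => //.
    move=> t /y_bnd /andP[y0 y1]; have /andP[s0 s1] := s_bnd t.
    by have /andP[a0 a1] := a_bnd t; apply/andP; split; lra.
  rewrite -oppr_ge0 -sumrN; apply: le_trans feasQ _.
  by apply: ler_sum_nat => t _; lra.
have frameZ : \sum_(m <= t < m + T) Z t * (eps - s t - y t) <=
    T%:R * (T%:R - 1) / 2 * Num.max ((smax + xmax) ^+ 2) (eps ^+ 2).
  apply: frame_inner_product Z_step _ (Z_ge0 m) _ => //.
    move=> t /y_bnd /andP[y0 y1]; have /andP[s0 s1] := s_bnd t.
    by apply/andP; split; have := eps_ge0; lra.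
  rewrite -oppr_ge0 -sumrN; apply: le_trans feasZ _.
  by apply: ler_sum_nat => t _; lra.
have slots : \sum_(m <= t < m + T) (L t.+1 - L t + V * (g t * x t)) <=
    \sum_(m <= t < m + T) (B + V * (g t * y t)
      + (Q t * (a t - s t - y t) + Z t * (eps - s t - y t))).
  apply: ler_sum_nat => t /y_bnd y_t.
  apply: slot_drift (Q_ge0 t) (Z_ge0 t) (s_bnd t) (a_bnd t) (x_bnd t) _ _ _ => //.
  by rewrite xE; apply: greedy_le.
move: slots; rewrite big_split /= telescope_sumr ?leq_addr // big_split /=.
rewrite [X in _ <= X + _]big_split [X in _ <= _ + X]big_split /= -!mulr_sumr.
rewrite sumr_const_nat addKn -[B *+ T]mulr_natl => slots.
have maxQ : Num.max ((smax + xmax) ^+ 2) (amax ^+ 2) <=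
            (smax + xmax) ^+ 2 + amax ^+ 2.
  by rewrite ge_max lerDl lerDr !sqr_ge0.
have BE : 2 * B = (smax + xmax) ^+ 2 + amax ^+ 2
    + Num.max ((smax + xmax) ^+ 2) (eps ^+ 2).
  by rewrite maxC /B /Bconst; set M := Num.max _ _; field.
have T_ge0 : 0 <= T%:R * (T%:R - 1) / 2 :> R.
  case: (T) => [|n]; first by rewrite !mul0r.
  by rewrite -(natr1 n) addrK divr_ge0 // mulr_ge0 ?addr_ge0.
(* The slots contribute T B and the drift inside the frame 2 B T (T - 1) / 2;
   the two add up to T^2 B. *)
have errors : T%:R * (T%:R - 1) / 2 * Num.max ((smax + xmax) ^+ 2) (amax ^+ 2)
    + T%:R * (T%:R - 1) / 2 * Num.max ((smax + xmax) ^+ 2) (eps ^+ 2)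
    <= T%:R * (T%:R - 1) * B.
  rewrite -mulrDr (_ : T%:R * (T%:R - 1) * B = T%:R * (T%:R - 1) / 2 * (2 * B)).
    by rewrite BE ler_wpM2l // lerD2r.
  by field.
rewrite expr2; lra.
Qed.

(** Buying xmax on every slot meets both constraints because xmax dominates
    amax and eps, so the optimal value is the infimum of a nonempty set. *)
Lemma xmax_feasible T r : lookahead_feasible s a eps xmax T r (fun=> xmax).
Proof.
split=> [||t _]; last by rewrite xmax_ge0 lexx.
- apply: sumr_ge0 => t _; have /andP[s0 _] := s_bnd t.
  by have /andP[_ a1] := a_bnd t; have := amax_le; lra.
- apply: sumr_ge0 => t _; have /andP[s0 _] := s_bnd t.
  by have := eps_le; lra.
Qed.

(** The bound of [frame_drift] does not involve y beyond its cost, hence passes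
    to the infimum. *)
Lemma frame_cost T r : (0 < T)%N ->
  L (r.+1 * T)%N - L (r * T)%N
    + V * (\sum_(r * T <= t < r.+1 * T) g t * x t)
  <= T%:R ^+ 2 * B + V * T%:R * lookahead_opt s a g eps xmax T r.
Proof.
move=> T_gt0; have VT_gt0 : 0 < V * T%:R by rewrite mulr_gt0 ?ltr0n.
rewrite -lerBlDl -ler_pdivrMl //; apply: lb_le_inf.
  by exists (lookahead_cost g T r (fun=> xmax)), (fun=> xmax) => //; exact: xmax_feasible.
move=> _ [y feas <-]; rewrite ler_pdivrMl // lerBlDl /lookahead_cost.
apply: le_trans (frame_drift feas) _; rewrite lerD2l.
by rewrite -mulrA mulVKf // pnatr_eq0 -lt0n.
Qed.

Lemma average_cost T N : (0 < T)%N -> (0 < N)%N ->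
  (N * T)%:R^-1 * \sum_(0 <= t < N * T) g t * x t
  <= N%:R^-1 * \sum_(0 <= r < N) lookahead_opt s a g eps xmax T r
     + B * T%:R / V.
Proof.
move=> T_gt0 N_gt0.
have := @ler_sum_nat _ 0 N _ _ (fun r _ => @frame_cost T r T_gt0).
rewrite big_split /= (telescope_sumr (fun r => L (r * T)%N)) //.
rewrite [X in _ <= X]big_split /= -!mulr_sumr -big_nat_mul.
rewrite sumr_const_nat subn0 -[B *+ N]mulr_natl.
have -> : L (0 * T)%N = 0 by rewrite mul0n /L Q0 Z0 expr0n /= addr0 mul0r.
have L_ge0 : 0 <= L (N * T)%N by rewrite divr_ge0 // addr_ge0 // sqr_ge0.
set c := \sum_(0 <= t < N * T) _; set d := \sum_(_ <= _ < _) _ => total.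
have [N0 T0] : N%:R != 0 :> R /\ T%:R != 0 :> R by rewrite !pnatr_eq0 -!lt0n.
have V0 : V != 0 by rewrite gt_eqF.
have VNT : 0 < V * (N * T)%:R by rewrite mulr_gt0 // ltr0n muln_gt0 N_gt0.
rewrite -(ler_pM2l VNT) natrM.
have -> : V * (N%:R * T%:R) * ((N%:R * T%:R)^-1 * c) = V * c.
  by field; rewrite N0 T0.
have -> : V * (N%:R * T%:R) * (N%:R^-1 * d + B * T%:R / V) =
          N%:R * (T%:R ^+ 2 * B) + V * T%:R * d.
  by field; rewrite N0 V0.
by lra.
Qed.

End Controller.

Theorem theorem3 (R : realType) (V eps smax amax gmax xmax : R)
    (s a g x Q Z : nat -> R)
    (V_gt0 : 0 < V) (eps_ge0 : 0 <= eps)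
    (xmax_ge : Num.max amax eps <= xmax)
    (s_bnd : forall t, 0 <= s t <= smax)
    (a_bnd : forall t, 0 <= a t <= amax)
    (g_bnd : forall t, 0 <= g t <= gmax)
    (Q0 : Q 0%N = 0) (Z0 : Z 0%N = 0)
    (xE : forall t, x t = if Q t + Z t <= V * g t then 0 else xmax)
    (QE : forall t, Q t.+1 = Num.max (Q t - s t - x t) 0 + a t)
    (ZE : forall t,
      Z t.+1 = Num.max (Z t - s t - x t + eps * (if 0 < Q t then 1 else 0)) 0) :
  [/\ forall t, Q t <= Qmax V gmax amax,
      0 < eps -> forall t, fulfilled_within s x Q t (Dmax V gmax amax eps)
    & forall T N : nat, (0 < T)%N -> (0 < N)%N ->
      (N * T)%:R^-1 * \sum_(0 <= tau < N * T) g tau * x tau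
      <= N%:R^-1 * \sum_(0 <= r < N) lookahead_opt s a g eps xmax T r
         + Bconst smax amax xmax eps * T%:R / V].
Proof.
split.
- exact: (Q_le V_gt0 eps_ge0 xmax_ge s_bnd a_bnd g_bnd Q0 Z0 xE QE ZE).
- exact: (delay_bound V_gt0 eps_ge0 xmax_ge s_bnd a_bnd g_bnd Q0 Z0 xE QE ZE).
- exact: (average_cost V_gt0 eps_ge0 xmax_ge s_bnd a_bnd Q0 Z0 xE QE ZE).
Qed.
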